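(* Let $p$ be a prime. For integers $a\ge b\ge 0$ define \[ K(a,b) = \frac{\prod_{i=1}^a (1-1/p^i)}{p^{\binom{b+1}{2}} \prod_{i=1}^b (1-1/p^i) \prod_{j=1}^{\lfloor (a-b)/2 \rfloor} (1-1/p^{2j}) }, \] and for $a=\infty$ and integer $b\ge0$ define \[ K(\infty,b)=\frac{\prod_{i=1}^\infty (1-1/p^i)}{p^{\binom{b+1}{2}} \prod_{i=1}^b (1-1/p^i) \prod_{j=1}^{\infty} (1-1/p^{2j}) }. \] Starting with $\lambda_0'=\infty$, define random nonnegative integers $\lambda_1',\lambda_2',\dots$ in succession by the rule that if $\lambda_i'=a$, then $\lambda_{i+1}'=b$ (with $b\le a$) with probability $K(a,b)$. Then (almost surely) $\lambda_1'\ge\lambda_2'\ge\cdots$ are the column lengths of a partition $\lambda$ (i.e. $\lambda'=(\lambda_1',\lambda_2',\dots)$ is its transpose), and $\lambda$ is distributed according to the probability measure \[ \pi(\lambda)=\frac{\prod_{i \text{ odd},\, i\ge1} (1-1/p^i)}{p^{\sum_i \mu_i(\mu_i+1)/2} \prod_{i=1}^{\lambda_1} \prod_{j=1}^{\lfloor (\mu_i - \mu_{i+1})/2 \rfloor}(1-1/p^{2j})},\qquad \mu=\lambda'. \]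
   Context: For a partition $\lambda$, $\lambda'$ (also written $\mu$) is its transpose: $\mu_i$ is the number of parts of $\lambda$ of size at least $i$; $\lambda_1$ is the largest part and $\mu_{\lambda_1+1}=0$. Empty products equal $1$. *)

(* Defs.v *)
From HB Require Import structures.
From mathcomp Require Import all_boot all_order all_algebra.
From mathcomp Require Import all_classical all_reals all_analysis.

Set Implicit Arguments.
Unset Strict Implicit.
Unset Printing Implicit Defensive.

Import Order.TTheory GRing.Theory Num.Theory.
Import numFieldNormedType.Exports.

Local Open Scope classical_set_scope.
Local Open Scope ring_scope.

Definition is_part (s : seq nat) : bool := sorted geq s && (0%N \notin s).

Record intpart := IntPart { parts :> seq nat; partsP : is_part parts }.

HB.instance Definition _ := [isSub for parts].
HB.instance Definition _ := [Countable of intpart by <:].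

Definition largest_part (lam : intpart) : nat := head 0%N lam.

(* The i-th part of the transpose of lam, indexed from i = 1. *)
Definition part_col (lam : intpart) (i : nat) : nat :=
  count (fun x => (i <= x)%N) lam.

Definition infprod (R : realType) (f : nat -> R) : R :=
  lim ((fun n => \prod_(1 <= i < n.+1) f i) @ \oo).

Definition infprod_odd (R : realType) (f : nat -> R) : R :=
  lim ((fun n => \prod_(1 <= i < n.+1 | odd i) f i) @ \oo).

(* [None] stands for a = oo.  The value is only meaningful for b <= a. *)
Definition K (R : realType) (p : nat) (a : option nat) (b : nat) : R :=
  match a with
  | Some a =>
      (\prod_(1 <= i < a.+1) (1 - 1 / p%:R ^+ i)) /
      (p%:R ^+ 'C(b.+1, 2) * (\prod_(1 <= i < b.+1) (1 - 1 / p%:R ^+ i)) *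
       \prod_(1 <= j < ((a - b) %/ 2).+1) (1 - 1 / p%:R ^+ (2 * j)))
  | None =>
      infprod (fun i => 1 - 1 / p%:R ^+ i) /
      (p%:R ^+ 'C(b.+1, 2) * (\prod_(1 <= i < b.+1) (1 - 1 / p%:R ^+ i)) *
       infprod (fun j => 1 - 1 / p%:R ^+ (2 * j)))
  end.

Definition le_state (b : nat) (a : option nat) : bool :=
  if a is Some a then (b <= a)%N else true.

Definition trans (R : realType) (p : nat) (a : option nat) (b : nat) : R :=
  if le_state b a then K R p a b else 0.

(* [X j] is the random integer lambda'_(j+1), so that [state X i w] is
   lambda'_i, with lambda'_0 = oo. *)
Definition state (T : Type) (X : nat -> T -> nat) (i : nat) (w : T)
    : option nat :=
  if i is j.+1 then Some (X j w) else None.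

(* Conditionally on lambda'_0 = h 0, ..., lambda'_n = h n, the next value is b
   with probability [trans R p (h n) b]; multiplying by the probability of the
   history avoids conditioning on null events. *)
Definition column_chain (R : realType) (p : nat) (d : measure_display)
    (T : measurableType d) (P : probability T R) (X : nat -> {RV P >-> nat})
    : Prop :=
  forall (n : nat) (h : nat -> option nat) (b : nat),
    let H := [set w | forall i, (i <= n)%N -> state X i w = h i] in
    (P (H `&` [set w | state X n.+1 w = Some b])
     = P H * (trans R p (h n) b)%:E)%E.

Definition is_transpose (c : nat -> nat) (lam : intpart) : Prop :=
  forall j, c j = part_col lam j.+1.

Definition pi_part (R : realType) (p : nat) (lam : intpart) : R :=
  let mu := part_col lam in
  infprod_odd (fun i => 1 - 1 / p%:R ^+ i) /
  (p%:R ^+ (\sum_(1 <= i < (largest_part lam).+1) (mu i * (mu i).+1) %/ 2)%N *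
   \prod_(1 <= i < (largest_part lam).+1)
     \prod_(1 <= j < ((mu i - mu i.+1) %/ 2).+1) (1 - 1 / p%:R ^+ (2 * j))).

(* Main.v *)
Require Import Defs.
From HB Require Import structures.
From mathcomp Require Import all_boot all_order all_algebra.
From mathcomp Require Import all_classical all_reals all_analysis.
From mathcomp Require Import ring lra.

Import Order.TTheory GRing.Theory Num.Theory.
Import numFieldNormedType.Exports.

Local Open Scope classical_set_scope.
Local Open Scope ring_scope.

(* Put q = 1/p and (q)_n = (1 - q) ... (1 - q^n).  That K(a, .) sums to 1 is the
   coefficient of z^a in the product of the generating functions
   (-qz; q)_oo and (1 + z) / (z^2; q^2)_oo, which is 1 / (z; q)_oo; for a = oo
   one lets a tend to infinity.  Along the columns of a partition the factors
   (q)_a of the kernel telescope, so the chain follows the columns of lambda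
   with probability pi(lambda).  The total weight W(a) of the paths from a to 0
   is at most 1 and satisfies W(a) = K(a, 0) + sum_(1 <= b <= a) K(a, b) W(b),
   whence W(a) = 1 for all a by induction.  Since transposition is a bijection,
   pi has total mass W(oo) = 1, so almost surely the chain is the transpose of
   some partition. *)

(** * Finite q-Pochhammer symbols and the two coefficient sequences *)

Definition qpoch {R : realType} (q : R) (n : nat) : R :=
  \prod_(1 <= i < n.+1) (1 - q ^+ i).

(** By Euler, the coefficient of z^b in the product of the 1 + q^i z over i >= 1. *)
Definition qexp_coef {R : realType} (q : R) (b : nat) : R :=
  q ^+ 'C(b.+1, 2) / qpoch q b.

(** The coefficient of z^n in (1 + z) / (z^2; q^2)_oo; the factor 1 + z makes each even coefficient
    occur twice. *)
Definition qhalf {R : realType} (q : R) (n : nat) : R :=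
  (qpoch (q ^+ 2) (n %/ 2))^-1.

Section qpochhammer.
Context {R : realType}.
Variable q : R.
Hypothesis q_gt0 : 0 < q.
Hypothesis q_lt1 : q < 1.

Lemma onesubX_gt0 i : (0 < i)%N -> 0 < 1 - q ^+ i.
Proof. by move=> i0; rewrite subr_gt0 exprn_ilt1 ?ltW// -lt0n. Qed.

Lemma qpoch0 : qpoch q 0 = 1.
Proof. by rewrite /qpoch big_geq. Qed.

Lemma qpochS n : qpoch q n.+1 = qpoch q n * (1 - q ^+ n.+1).
Proof. by rewrite /qpoch big_nat_recr. Qed.

Lemma qpoch_gt0 n : 0 < qpoch q n.
Proof.
elim: n => [|n ih]; first by rewrite qpoch0.
by rewrite qpochS mulr_gt0// onesubX_gt0.
Qed.

Lemma qexp_coef_gt0 b : 0 < qexp_coef q b.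
Proof. by rewrite divr_gt0 ?qpoch_gt0// exprn_gt0. Qed.

(** The coefficient of z^(b+1) in G(z) = (1 + q z) G(q z), where G generates [qexp_coef q]. *)
Lemma qexp_coefS b :
  (1 - q ^+ b.+1) * qexp_coef q b.+1 = q ^+ b.+1 * qexp_coef q b.
Proof.
rewrite /qexp_coef qpochS binS bin1 exprD.
have := onesubX_gt0 b.+1 isT; have := qpoch_gt0 b.
set x := qpoch q b; set y := q ^+ b.+1 => x0 y0.
by field; rewrite !gt_eqF.
Qed.

End qpochhammer.

(** * The convolution identity behind the row sums for finite a *)

Section finite_identity.
Context {R : realType}.
Variable q : R.
Hypothesis q_gt0 : 0 < q.
Hypothesis q_lt1 : q < 1.

Let q2_gt0 : 0 < q ^+ 2. Proof. by rewrite exprn_gt0. Qed.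
Let q2_lt1 : q ^+ 2 < 1. Proof. by rewrite exprn_ilt1// ltW. Qed.

Lemma qhalf_gt0 n : 0 < qhalf q n.
Proof. by rewrite invr_gt0 qpoch_gt0. Qed.

(* Shifting the indices by 2 makes the coefficients of z^-1 and z^-2
   (which are 0) available. *)
Let hh k : R := if k is k'.+2 then qhalf q k' else 0.

(** The coefficient of z^n in H(q z) = (1 + q z) (1 - z) H(z). It is checked by parity of n: [key]
    relates consecutive even indices, and an odd index repeats the even one before it. *)
Let hh_rec n : (1 - q ^+ n) * hh n.+2 = (1 - q) * hh n.+1 + q * hh n.
Proof.
have key m : (1 - q ^+ m.+1.*2) * qhalf q m.+1.*2 = qhalf q m.*2.
  have := qpoch_gt0 _ q2_gt0 q2_lt1 m; have := onesubX_gt0 _ q_gt0 q_lt1 m.+1.*2 isT.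
  rewrite /qhalf -!muln2 !mulnK// qpochS -exprM (mulnC 2%N).
  set x := q ^+ _; set y := qpoch _ _ => x0 y0; field.
  by rewrite !gt_eqF.
have odd_qhalf m : qhalf q m.*2.+1 = qhalf q m.*2.
  by rewrite /qhalf !divn2 /= !uphalf_double doubleK.
case: n => [|[|n]] /=.
- by rewrite expr0 subrr !mul0r mulr0 mulr0 addr0.
- by rewrite /qhalf divn_small// mulr0 addr0.
have [m [->|->]] : exists m, n = m.*2 \/ n = m.*2.+1.
- exists n./2; rewrite -{1 3}(odd_double_half n).
  by case: (odd n); [right|left].
- have := key m; rewrite -doubleS odd_qhalf => ->; ring.
- have := key m; rewrite -doubleS !odd_qhalf => <-.
  rewrite (exprS q m.+1.*2); ring.
Qed.

(* With G and H the generating functions of [qexp_coef q] and [qhalf q], this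
   is the functional equation (GH)(q z) = (1 - z) (GH)(z), obtained from
   G(z) = (1 + q z) G(q z) and H(q z) = (1 + q z) (1 - z) H(z). *)
Lemma sum_qexp_coef_qhalf a :
  \sum_(0 <= b < a.+1) qexp_coef q b * qhalf q (a - b) = (qpoch q a)^-1.
Proof.
pose S a := \sum_(b < a.+1) qexp_coef q b * hh (a.+2 - b).
suff SE n : S n = (qpoch q n)^-1.
  rewrite -SE /S big_mkord; apply: eq_bigr => i _.
  by rewrite !subSn// ?leqW// -ltnS.
elim: n => [|n ih].
  rewrite /S big_ord1/= /qexp_coef /qhalf div0n !qpoch0.
  by rewrite expr0 invr1 !mulr1.
rewrite qpochS invfM -ih.
have d0 := onesubX_gt0 _ q_gt0 q_lt1 n.+1 isT.
apply: (mulIf (lt0r_neq0 d0)); rewrite mulfVK ?lt0r_neq0// mulrC.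
rewrite /S big_distrr/=.
(* Split 1 - q^(n+1) as (1 - q^b) + q^b (1 - q^(n+1-b)) and apply [hh_rec] to the second part. *)
rewrite (eq_bigr (fun b : 'I_n.+2 =>
    (1 - q ^+ b) * qexp_coef q b * hh (n.+3 - b) +
    q ^+ b * qexp_coef q b * (1 - q) * hh (n.+2 - b) +
    q ^+ b.+1 * qexp_coef q b * hh (n.+1 - b))); last first.
  move=> b _; have bn : (b <= n.+1)%N by rewrite -ltnS.
  have := hh_rec (n.+1 - b); rewrite -(subSn bn) -(subSn (leqW bn)).
  have -> : q ^+ n.+1 = q ^+ b * q ^+ (n.+1 - b) by rewrite -exprD subnKC.
  set x := hh (n.+3 - b); set y := hh (n.+2 - b); set z := hh (n.+1 - b).
  move=> e; rewrite exprS.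
  transitivity ((1 - q ^+ b) * qexp_coef q b * x +
    q ^+ b * qexp_coef q b * ((1 - q ^+ (n.+1 - b)) * x)); first by ring.
  rewrite e; ring.
(* The boundary terms vanish: 1 - q^0 = 0 at the bottom, and [hh 0 = hh 1 = 0] at the top. *)
rewrite big_split/= big_split/= [X in X + _ + _]big_ord_recl expr0 subrr !mul0r add0r.
rewrite [X in _ + X + _]big_ord_recr/= subSnn mulr0 addr0.
rewrite [X in _ + X]big_ord_recr/= subnn mulr0 addr0.
rewrite [X in _ + X]big_ord_recr/= subSnn mulr0 addr0.
have -> : \sum_(i < n) q ^+ i.+1 * qexp_coef q i * hh (n.+1 - i) =
          \sum_(i < n.+1) (1 - q ^+ i) * qexp_coef q i * hh (n.+2 - i).
  rewrite [RHS]big_ord_recl expr0 subrr !mul0r add0r.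
  by apply: eq_bigr => i _; rewrite lift0 qexp_coefS// subSS.
(* All three sums now carry [qexp_coef q i * hh (n.+2 - i)], with factors q^(i+1), q^i (1 - q) and 1
   - q^i, which add up to 1. *)
rewrite -!big_split/=; apply: eq_bigr => i _.
rewrite /bump leq0n add1n subSS qexp_coefS// exprS; ring.
Qed.

End finite_identity.

(** * Convergence and positivity of the infinite product *)

Definition qpochoo {R : realType} (q : R) : R := limn (qpoch q).

Section infinite_product.
Context {R : realType}.
Variable q : R.
Hypothesis q_gt0 : 0 < q.
Hypothesis q_le2V : q <= 2^-1.

Let q_lt1 : q < 1. Proof. by move: q_le2V; lra. Qed.

(* The first three terms of Euler's pentagonal number series. *)
Lemma qpoch_ge n : 1 - q - q ^+ 2 + q ^+ n.+1 <= qpoch q n.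
Proof.
elim: n => [|[|n] ih].
- by rewrite qpoch0; move: q_gt0; nra.
- by rewrite qpochS qpoch0; move: q_gt0; nra.
rewrite qpochS; apply: le_trans (ler_wpM2r (ltW (onesubX_gt0 _ q_gt0 q_lt1 _ _)) ih) => //.
(* With x = q^(n+2), the two sides differ by x (q^2 - x). This needs x <= q^2, so the index 1 was
   treated apart. *)
have x0 : 0 < q ^+ n.+2 by rewrite exprn_gt0.
have x1 : q ^+ n.+2 <= q ^+ 2 by rewrite ler_wiXn2l// ltW.
rewrite (exprS q n.+2); set x := q ^+ n.+2 in x0 x1 *; move: q_gt0; nra.
Qed.

Lemma qpoch_nonincreasing : nonincreasing_seq (qpoch q).
Proof.
apply/nonincreasing_seqP => n; rewrite qpochS ler_piMr ?ltW ?qpoch_gt0//.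
by rewrite ltrBlDr ltrDl exprn_gt0.
Qed.

Lemma cvg_qpoch : qpoch q @ \oo --> qpochoo q.
Proof.
apply: nonincreasing_is_cvgn; first exact: qpoch_nonincreasing.
by exists 0 => _ [n _ <-]; rewrite ltW// qpoch_gt0.
Qed.

Lemma qpochoo_le n : qpochoo q <= qpoch q n.
Proof.
by apply: nonincreasing_cvgn_ge; [exact: qpoch_nonincreasing|exact: cvg_qpoch].
Qed.

(** Since q <= 1/2, the lower bound 1 - q - q^2 of all partial products is at least 1/4. *)
Lemma qpochoo_gt0 : 0 < qpochoo q.
Proof.
apply: (@lt_le_trans _ _ (1 - q - q ^+ 2)); first by move: q_gt0 q_le2V; nra.
apply: limr_ge; first exact: cvg_qpoch.
apply: nearW => n; apply: le_trans (qpoch_ge n).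
by rewrite lerDl ltW// exprn_gt0.
Qed.

End infinite_product.

(** * The rows of the kernel are probability distributions *)

Section kernel.
Context {R : realType}.
Variable p : nat.
Hypothesis p_gt1 : (1 < p)%N.

Local Notation q := (p%:R^-1 : R).

Lemma inv_gt0 : 0 < q.
Proof. by rewrite invr_gt0 ltr0n ltnW. Qed.

Lemma inv_le2V : q <= 2^-1.
Proof. by rewrite lef_pV2 ?posrE ?ltr0n// ?(ltnW p_gt1)// ler_nat. Qed.

Lemma inv_lt1 : q < 1.
Proof. by have := inv_le2V; lra. Qed.

Lemma inv_sqr_gt0 : 0 < q ^+ 2.
Proof. by rewrite exprn_gt0 ?inv_gt0. Qed.

Lemma inv_sqr_le2V : q ^+ 2 <= 2^-1.
Proof. have := inv_le2V; have := inv_gt0; nra. Qed.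

Lemma inv_sqr_lt1 : q ^+ 2 < 1.
Proof. by have := inv_sqr_le2V; lra. Qed.

Hint Resolve inv_gt0 inv_le2V inv_lt1 inv_sqr_gt0 inv_sqr_le2V inv_sqr_lt1 : core.

Lemma prod_qpoch n :
  \prod_(1 <= i < n.+1) (1 - 1 / p%:R ^+ i) = qpoch q n.
Proof. by apply: eq_bigr => i _; rewrite div1r exprVn. Qed.

Lemma prod_qpoch_sqr n :
  \prod_(1 <= i < n.+1) (1 - 1 / p%:R ^+ (2 * i)) = qpoch (q ^+ 2) n.
Proof. by apply: eq_bigr => i _; rewrite div1r -exprVn exprM. Qed.

Lemma infprod_qpoch : infprod (fun i => 1 - 1 / p%:R ^+ i) = qpochoo q.
Proof. by rewrite /infprod; under eq_fun do rewrite prod_qpoch. Qed.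

Lemma infprod_qpoch_sqr :
  infprod (fun i => 1 - 1 / p%:R ^+ (2 * i)) = qpochoo (q ^+ 2).
Proof. by rewrite /infprod; under eq_fun do rewrite prod_qpoch_sqr. Qed.

(** The even factors of (q)_oo form (q^2; q^2)_oo. The partial products [u] converge by
    monotonicity, so their limit can be read along even indices, where the quotient is exact. *)
Lemma infprod_odd_qpoch :
  infprod_odd (fun i => 1 - 1 / p%:R ^+ i) = qpochoo q / qpochoo (q ^+ 2).
Proof.
pose u n : R := \prod_(1 <= i < n.+1 | odd i) (1 - q ^+ i).
have -> : infprod_odd (fun i => 1 - 1 / p%:R ^+ i) = limn u.
  rewrite /infprod_odd; congr (limn _); apply/funext => n.
  by apply: eq_bigr => i _; rewrite div1r exprVn.
have f_gt0 i : (0 < i)%N -> 0 < 1 - q ^+ i by exact: onesubX_gt0.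
have uS n : u n.+1 = if odd n.+1 then u n * (1 - q ^+ n.+1) else u n.
  by rewrite /u big_mkcond big_nat_recr//= -big_mkcond/=; case: ifP; rewrite ?mulr1.
have u_ge0 n : 0 <= u n.
  elim: n => [|n ih]; first by rewrite /u big_geq.
  by rewrite uS; case: ifP => // _; rewrite mulr_ge0// ltW// f_gt0.
have cu : cvgn u.
  apply: nonincreasing_is_cvgn; last by exists 0 => _ [n _ <-].
  apply/nonincreasing_seqP => n; rewrite uS; case: ifP => // _.
  by rewrite ler_piMr// gerBl exprn_ge0// ltW.
have uE n : u (2 * n)%N = qpoch q (2 * n) / qpoch (q ^+ 2) n.
  apply: (mulIf (lt0r_neq0 (qpoch_gt0 _ inv_sqr_gt0 inv_sqr_lt1 n))).
  rewrite mulfVK ?lt0r_neq0 ?qpoch_gt0//.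
  elim: n => [|n ih]; first by rewrite muln0 /u !qpoch0 big_geq// mulr1.
  rewrite mulnS 2!uS /= mul2n odd_double/= -mul2n !qpochS -ih -exprM mulnS.
  ring.
apply: (@cvg_lim _ (@Rhausdorff R)).
have c2 : (fun n => u (2 * n)%N) @ \oo --> limn u.
  by apply: (cvg_comp (fun n => 2 * n)%N u) cu; exact: cvg_mulnl.
suff : (fun n => u (2 * n)%N) @ \oo --> qpochoo q / qpochoo (q ^+ 2).
  by move=> /(cvg_unique (@Rhausdorff R) c2) <-; exact: cu.
rewrite (funext uE); apply: cvgM.
  apply: (cvg_comp (fun n => 2 * n)%N (qpoch q)); first exact: cvg_mulnl.
  exact: cvg_qpoch.
by apply: cvgV; [rewrite lt0r_neq0// qpochoo_gt0|exact: cvg_qpoch].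
Qed.

Lemma trans_Some a b : (b <= a)%N ->
  trans R p (Some a) b = qpoch q a * (qexp_coef q b * qhalf q (a - b)).
Proof.
move=> ba; rewrite /trans /= ba !prod_qpoch prod_qpoch_sqr /qexp_coef /qhalf.
by rewrite !invfM -!exprVn !mulrA.
Qed.

Lemma trans_Some_lt a b : (a < b)%N -> trans R p (Some a) b = 0.
Proof. by move=> ab; rewrite /trans /= leqNgt ab. Qed.

Lemma trans_None b :
  trans R p None b = qpochoo q * (qexp_coef q b / qpochoo (q ^+ 2)).
Proof.
rewrite /trans /= infprod_qpoch prod_qpoch infprod_qpoch_sqr /qexp_coef.
by rewrite !invfM -!exprVn !mulrA.
Qed.

Lemma trans_ge0 a b : 0 <= trans R p a b.
Proof.
case: a => [a|]; last first.
  rewrite trans_None; apply: mulr_ge0; [|apply: divr_ge0]; apply: ltW.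
  - exact: qpochoo_gt0.
  - exact: qexp_coef_gt0.
  - exact: qpochoo_gt0.
have [ba|/trans_Some_lt->//] := leqP b a.
rewrite trans_Some//; apply: mulr_ge0; [|apply: mulr_ge0]; apply: ltW.
- exact: qpoch_gt0.
- exact: qexp_coef_gt0.
- exact: qhalf_gt0.
Qed.

Lemma sum_trans_Some a n : (a < n)%N ->
  \sum_(0 <= b < n) trans R p (Some a) b = 1.
Proof.
move=> an; rewrite (big_cat_nat (n := a.+1))//=.
rewrite [X in _ + X]big1_seq ?addr0; last first.
  by move=> b /andP[_]; rewrite mem_index_iota => /andP[ab _]; rewrite trans_Some_lt.
rewrite (eq_big_nat _ _ (F2 := fun b => qpoch q a * (qexp_coef q b * qhalf q (a - b)))).
  rewrite -big_distrr/= sum_qexp_coef_qhalf// mulfV// lt0r_neq0//.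
  exact: qpoch_gt0.
by move=> b /andP[_ ba]; rewrite trans_Some.
Qed.

Lemma cvg_qhalf : qhalf q @ \oo --> (qpochoo (q ^+ 2))^-1.
Proof.
apply: (cvgV (f := fun n => qpoch (q ^+ 2) (n %/ 2))).
  by rewrite lt0r_neq0// qpochoo_gt0.
apply: (cvg_comp (fun n => n %/ 2)%N (qpoch (q ^+ 2))); first exact: cvg_divnr.
exact: cvg_qpoch.
Qed.

Lemma cvg_trans_None b : trans R p (Some a) b @[a --> \oo] --> trans R p None b.
Proof.
have : qpoch q a * (qexp_coef q b * qhalf q (a - b)) @[a --> \oo] --> trans R p None b.
  rewrite trans_None; apply: cvgM; first exact: cvg_qpoch.
  apply: cvgMr.
  by apply: (cvg_comp (fun n => n - b)%N (qhalf q)) cvg_qhalf; exact: cvg_subnr.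
apply: cvg_trans; apply: near_eq_cvg; near=> a.
by rewrite trans_Some//; near: a; exists b.
Unshelve. all: by end_near. Qed.

Lemma sum_trans_None_le1 n : \sum_(0 <= b < n) trans R p None b <= 1.
Proof.
have c : \sum_(0 <= b < n) trans R p (Some a) b @[a --> \oo] -->
         \sum_(0 <= b < n) trans R p None b.
  elim: n => [|n ih].
    by rewrite big_geq//; under eq_fun do rewrite big_geq//; exact: cvg_cst.
  rewrite big_nat_recr//=; under eq_fun do rewrite big_nat_recr//=.
  by apply: cvgD => //; exact: cvg_trans_None.
rewrite -(cvg_lim (@Rhausdorff R) c); apply: limr_le; first exact: cvgP c.
(* The range is enlarged to contain the whole row of a, whose total is 1. *)
apply: nearW => a; rewrite -(sum_trans_Some a (maxn a.+1 n)) ?leq_maxl//.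
rewrite [leRHS](big_cat_nat (n := n)) ?leq_maxr//= lerDl.
by apply: sumr_ge0 => *; exact: trans_ge0.
Qed.

(* [qhalf q] is bounded by its limit, hence K(a, b) <= (q)_a / (q)_oo K(oo, b). *)
Lemma sum_trans_None_ge n :
  qpochoo q / qpoch q n <= \sum_(0 <= b < n.+1) trans R p None b.
Proof.
rewrite ler_pdivrMr ?qpoch_gt0//.
have -> : qpochoo q = \sum_(0 <= b < n.+1) qpochoo q * trans R p (Some n) b.
  by rewrite -big_distrr/= sum_trans_Some// mulr1.
rewrite mulr_suml.
rewrite big_seq [leRHS]big_seq; apply: ler_sum => b.
rewrite mem_index_iota => /andP[_ bn]; rewrite trans_Some// trans_None.
have := qexp_coef_gt0 _ inv_gt0 inv_lt1 b; move: (qexp_coef _ b) => g g0.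
rewrite -!mulrA ler_pM2l ?qpochoo_gt0//.
rewrite [leLHS]mulrCA ler_pM2l// mulrC ler_pM2r ?qpoch_gt0//.
by rewrite lef_pV2 ?posrE ?qpoch_gt0 ?qpochoo_gt0// qpochoo_le.
Qed.

(** Letting a tend to infinity termwise yields only the bound 1; the lower bound (q)_oo / (q)_n,
    which tends to 1, shows that no mass escapes. *)
Lemma cvg_sum_trans_None :
  \sum_(0 <= b < n) trans R p None b @[n --> \oo] --> (1 : R).
Proof.
rewrite -cvg_shiftS/=.
apply: (@squeeze_cvgr _ _ _ _ (fun n => qpochoo q / qpoch q n) (fun=> 1)).
- by apply: nearW => n; rewrite sum_trans_None_ge sum_trans_None_le1.
- rewrite -[X in _ --> X](@mulfV _ (qpochoo q)) ?lt0r_neq0 ?qpochoo_gt0//.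
  apply: cvgMr; apply: cvgV; first by rewrite lt0r_neq0// qpochoo_gt0.
  exact: cvg_qpoch.
- exact: cvg_cst.
Qed.

Lemma nneseries_trans a : (\sum_(0 <= b <oo) (trans R p a b)%:E = 1)%E.
Proof.
apply: cvg_lim => //.
apply: (@cvg_trans _ ((fun n => (\sum_(0 <= b < n) trans R p a b)%:E) @ \oo)).
  by apply: near_eq_cvg; apply: nearW => n; rewrite sumEFin.
case: a => [a|]; last by apply: cvg_EFin; [exact: nearW|exact: cvg_sum_trans_None].
apply: cvg_near_cst; near=> n; rewrite sum_trans_Some//.
by near: n; exists a.+1.
Unshelve. all: by end_near. Qed.

End kernel.

(** * Total weight of the paths that reach 0 *)

Lemma ge0_esumZl {R : realType} {T : choiceType} (I : set T)
    (f : T -> \bar R) (r : R) : 0 <= r -> (forall i, 0 <= f i)%E ->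
  \esum_(i in I) (r%:E * f i)%E = (r%:E * \esum_(i in I) f i)%E.
Proof.
move=> r0 f0; rewrite /esum -ereal_supZl//; last first.
  apply/set0P; exists (\sum_(x \in set0) f x), set0 => //.
  exact: fsets_set0.
congr ereal_sup; apply/seteqP; split => [_ [A fA <-]|_ [_ [A fA <-] <-]].
  by exists (\sum_(x \in A) f x); [exists A|rewrite ge0_mule_fsumr].
by exists A => //; rewrite ge0_mule_fsumr.
Qed.

Section path_weight.
Context {R : realType}.
Variable p : nat.
Hypothesis p_gt1 : (1 < p)%N.

(* The entries of [c] are the successive nonzero values of the chain, each
   decreased by 1, so that every sequence encodes a path. *)
Fixpoint path_weight (a : option nat) (c : seq nat) : R :=
  if c is b :: c' then trans R p a b.+1 * path_weight (Some b.+1) c'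
  else trans R p a 0.

Lemma path_weight_ge0 a c : 0 <= path_weight a c.
Proof.
by elim: c a => [|b c ih] a /=; rewrite ?mulr_ge0// trans_ge0.
Qed.

Local Notation W S a := (\esum_(c in S) (path_weight a c)%:E).

(** First-step decomposition: the path drops to 0 at once, or it moves to b + 1 and continues in
    [S]. A general [S] covers both paths of bounded length and all paths. *)
Lemma esum_path_weight_cons (S : set (seq nat)) a :
  W [set c | c = [::] \/ S (behead c)] a =
  ((trans R p a 0)%:E +
   \sum_(0 <= b <oo) (trans R p a b.+1)%:E * W S (Some b.+1))%E.
Proof.
have w0 b c : (0%R <= (path_weight b c)%:E :> \bar R)%E.
  by rewrite lee_fin path_weight_ge0.
rewrite (esumID [set [::]])//; congr (_ + _)%E.
  rewrite (_ : _ `&` _ = [set [::]]); last first.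
    by apply/seteqP; split => [c []//|c /= ->]; split => //; left.
  by rewrite esum_set1.
rewrite (reindex_esum (setT `*`` (fun=> S)) _ (fun x => x.1 :: x.2))/=; last first.
  split => [[b c]/= [_ Sc]|[b c] [b' c'] _ _ /= [-> ->]//|[|b c] /= []].
  - by split => //; right.
  - by [].
  - by case=> // Sc _; exists (b, c).
under eq_esum do rewrite EFinM.
rewrite -(@esum_esum _ _ _ setT (fun=> S)
  (fun b c => (trans R p a b.+1)%:E * (path_weight (Some b.+1) c)%:E)%E); last first.
  by move=> b c _ _; rewrite mule_ge0// lee_fin trans_ge0.
rewrite nneseries_esumT; last first.
  by move=> b; rewrite mule_ge0 ?lee_fin ?trans_ge0// esum_ge0.
by apply: eq_esum => b _; rewrite ge0_esumZl// trans_ge0.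
Qed.

Lemma nneseries_trans_recl a :
  ((trans R p a 0)%:E + \sum_(0 <= b <oo) (trans R p a b.+1)%:E = 1)%E.
Proof.
rewrite -[RHS](@nneseries_trans R p p_gt1 a) [RHS]nneseries_recl//; last first.
  by move=> b _; rewrite lee_fin trans_ge0.
rewrite -(@nneseries_addn R (fun b => (trans R p a b)%:E) 1); last first.
  by move=> b; rewrite lee_fin trans_ge0.
by under [in RHS]eq_eseriesr do rewrite addn1.
Qed.

(** These are the paths that reach 0 within n transitions; by induction every tail weighs at most 1,
    and the row of a sums to 1. *)
Lemma esum_path_weight_size_le1 n a : (W [set c | size c < n]%N a <= 1)%E.
Proof.
elim: n a => [|n ih] a.
  rewrite (_ : [set _ | _] = set0) ?esum_set0//.
  by apply/seteqP; split => // c /=; rewrite ltn0.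
rewrite (_ : [set _ | _] = [set c | c = [::] \/ [set c | size c < n]%N (behead c)]).
  rewrite esum_path_weight_cons -[leRHS](nneseries_trans_recl a) leeD2l//.
  have W0 b : (0%R <= W [set c | size c < n]%N b)%E.
    by apply: esum_ge0 => c _; rewrite lee_fin path_weight_ge0.
  apply: lee_nneseries => [b _ _|b _].
    by rewrite mule_ge0 ?lee_fin ?trans_ge0.
  by rewrite -[leRHS]mule1 lee_pmul// lee_fin trans_ge0.
apply/seteqP; split => [[|b c]|[|b c]]//=; rewrite ?ltnS; first by left.
  by right.
by case.
Qed.

(** The sum is a supremum over finite sets of paths, and a finite set has bounded length. *)
Lemma esum_path_weight_le1 a : (W setT a <= 1)%E.
Proof.
apply: ge_ereal_sup => _ [X [finX _] <-].
have [s Xs] := (finite_seqP X).1 finX.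
pose n := (\max_(c <- s) size c).+1.
apply: le_trans (esum_path_weight_size_le1 n a).
apply: esum_ge; exists X => //; split => // c Xc /=.
rewrite ltnS; apply: leq_bigmax_seq => //.
by rewrite Xs in Xc.
Qed.

Lemma esum_path_weight_recl a : W setT a =
  ((trans R p a 0)%:E +
   \sum_(0 <= b <oo) (trans R p a b.+1)%:E * W setT (Some b.+1))%E.
Proof.
rewrite -esum_path_weight_cons; congr (esum _ _).
by apply/seteqP; split => // c _; right.
Qed.

(* The equation W(a) = K(a, 0) + sum_(1 <= b <= a) K(a, b) W(b) determines W(a)
   from the W(b) with b < a, because W(a) is finite and K(a, a) < 1. *)
Lemma esum_path_weight_Some a : W setT (Some a) = 1%E.
Proof.
elim/ltn_ind: a => a ih.
have w0 b : (0%R <= W setT b)%E.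
  by apply: esum_ge0 => c _; rewrite lee_fin path_weight_ge0.
have Wfin : W setT (Some a) \is a fin_num.
  by rewrite ge0_fin_numE// (le_lt_trans (esum_path_weight_le1 _))// ltry.
have := esum_path_weight_recl (Some a).
rewrite (nneseries_split 0 a); last first.
  by move=> b _; rewrite mule_ge0// lee_fin trans_ge0.
(* The index b stands for the value b + 1, so b >= a would be a move upwards. *)
rewrite [X in (_ + (_ + X))%E]eseries0 ?adde0; last first.
  by move=> b ab _; rewrite trans_Some_lt ?mul0e.
rewrite add0n.
case: a ih Wfin => [_ _|a ih Wfin].
  rewrite big_geq// adde0 => ->; congr EFin.
  by rewrite -[RHS](@sum_trans_Some R p p_gt1 0 1)// big_nat1.
rewrite -(fineK Wfin); set w := fine _.
rewrite big_nat_recr//= -(fineK Wfin) -/w.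
rewrite (eq_big_nat _ _ (F2 := fun b => (trans R p (Some a.+1) b.+1)%:E)); last first.
  by move=> b /andP[_ ba]; rewrite ih// mule1.
rewrite sumEFin -EFinM -!EFinD => -[].
have := @sum_trans_Some R p p_gt1 a.+1 a.+2 (ltnSn _).
rewrite big_nat_recl// big_nat_recr//=.
have : 0 < trans R p (Some a.+1) 0.
  have q0 := @inv_gt0 R p p_gt1; have q1 := @inv_lt1 R p p_gt1.
  rewrite trans_Some//; apply: mulr_gt0; first exact: qpoch_gt0.
  by apply: mulr_gt0; [exact: qexp_coef_gt0|exact: qhalf_gt0].
have : 0 <= \sum_(0 <= i < a) trans R p (Some a.+1) i.+1.
  by apply: sumr_ge0 => *; exact: trans_ge0.
set s := \sum_(_ <= _ < _) _; set t0 := trans _ _ _ 0; set t := trans _ _ _ _.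
move=> s0 t0_gt0 e1 e2; congr EFin.
(* Eliminate t between t0 + s + t = 1 and w = t0 + s + t w. *)
have : (1 - w) * (t0 + s) = 0 by nra.
by move=> /eqP; rewrite mulf_eq0 subr_eq0 => /orP[/eqP//|/eqP]; lra.
Qed.

Lemma esum_path_weight_None : W setT None = 1%E.
Proof.
rewrite esum_path_weight_recl -[RHS](nneseries_trans_recl None); congr (_ + _)%E.
by apply: eq_eseriesr => b _; rewrite esum_path_weight_Some mule1.
Qed.

End path_weight.

(** * Partitions, their columns and transposition *)

(** Both sides say that the cell in row i (from 0) and column j (from 1) lies in the Young diagram.
    The default 0 of [nth] is right beyond the last row because j > 0. *)
Lemma count_leq_gt (s : seq nat) i j : sorted geq s -> (0 < j)%N ->
  (i < count (leq j) s)%N = (j <= nth 0%N s i)%N.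
Proof.
move=> + j0; elim: s i => [|x s ih] i /=.
  by rewrite nth_nil ltn0 leqNgt j0.
move=> xs; have ss := path_sorted xs.
have [jx|xj] := leqP j x; first by case: i => [|i] /=; rewrite ?jx// add1n ltnS ih.
have small y : y \in s -> (y < j)%N.
  move: xs; rewrite (path_sortedE (rev_trans leq_trans)) => /andP[/allP h _].
  by move=> /h /= yx; exact: leq_ltn_trans xj.
rewrite add0n (_ : count _ s = 0)%N; last first.
  apply/eqP; rewrite -leqn0 leqNgt -has_count; apply/hasPn => y /small.
  by rewrite -ltnNge.
rewrite ltn0; apply/esym/negbTE; rewrite -ltnNge.
case: i => [//|i] /=; have [si|si] := ltnP i (size s).
  by apply: small; rewrite mem_nth.
by rewrite nth_default.
Qed.

Lemma part_sorted (lam : intpart) : sorted geq lam.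
Proof. by have /andP[] := partsP lam. Qed.

Lemma part_col_gt (lam : intpart) i j : (0 < j)%N ->
  (i < part_col lam j)%N = (j <= nth 0%N lam i)%N.
Proof. by apply: count_leq_gt; exact: part_sorted. Qed.

Lemma part_col_gt0 (lam : intpart) j : (0 < j)%N ->
  (0 < part_col lam j)%N = (j <= largest_part lam)%N.
Proof. by move=> j0; rewrite part_col_gt// nth0. Qed.

Lemma part_col_eq0 (lam : intpart) j : (largest_part lam < j)%N ->
  part_col lam j = 0%N.
Proof.
move=> lj; apply/eqP; rewrite -leqn0 leqNgt part_col_gt0 -?ltnNge//.
exact: leq_ltn_trans lj.
Qed.

Lemma part_col_le (lam : intpart) i j : (i <= j)%N ->
  (part_col lam j <= part_col lam i)%N.
Proof. by move=> ij; apply: sub_count => x; exact: leq_trans. Qed.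

Lemma part_col1 (lam : intpart) : part_col lam 1 = size lam.
Proof.
apply/eqP; rewrite -all_count; apply/allP => x xl; rewrite lt0n.
by apply: contraTN xl => /eqP ->; have /andP[] := partsP lam.
Qed.

(** By [part_col_gt] the columns decide which j >= 1 lie below each part, hence determine the
    part. *)
Lemma part_col_inj (lam nu : intpart) :
  (forall j, part_col lam j.+1 = part_col nu j.+1) -> lam = nu.
Proof.
move=> e; apply/val_inj; apply: (@eq_from_nth _ 0%N).
  by rewrite -[LHS]part_col1 -[RHS]part_col1 e.
move=> i _; apply/eqP; rewrite eqn_leq.
have le_nth (u v : intpart) : (forall j, part_col u j.+1 = part_col v j.+1) ->
    (nth 0%N u i <= nth 0%N v i)%N.
  move=> uv; case E : (nth 0%N u i) => [//|j].
  by rewrite -part_col_gt// -uv part_col_gt// E.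
by rewrite !le_nth.
Qed.

(** The witness is the conjugate of [s]; reading its diagram and that of [s] by cells shows that
    conjugating again returns [s]. *)
Lemma transpose_exists (s : seq nat) : is_part s ->
  exists2 lam : intpart, largest_part lam = size s &
    forall j, part_col lam j.+1 = nth 0%N s j.
Proof.
move=> /andP[ss s0].
pose c j := count (leq j) s.
pose t := [seq c i | i <- iota 1 (head 0%N s)].
have tE i : nth 0%N t i = c i.+1.
  have [ih|hi] := ltnP i (head 0%N s).
    by rewrite (nth_map 0%N) ?size_iota// nth_iota// add1n.
  rewrite nth_default ?size_map ?size_iota//; apply/esym/eqP.
  by rewrite -leqn0 leqNgt count_leq_gt// nth0 -ltnNge ltnS.
have tP : is_part t.
  apply/andP; split.
    apply/(sortedP 0%N) => i _; rewrite !tE /=.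
    by apply: sub_count => x; exact: ltnW.
  apply/mapP => -[i]; rewrite mem_iota add1n ltnS => /andP[i0 ih] /eqP.
  by rewrite eq_sym -leqn0 leqNgt count_leq_gt// nth0 ih.
exists (IntPart tP) => [|j].
  rewrite /largest_part /= -nth0 tE; apply/eqP; rewrite -all_count.
  apply/allP => x xs; rewrite lt0n; apply: contraNneq s0 => <- //.
(* Column lengths are compared through the rows they meet. *)
have le_iff (m n : nat) : (forall i, (i < m)%N = (i < n)%N) -> m = n.
  move=> h; apply/eqP; rewrite eqn_leq; apply/andP; split.
    by case: m h => // m h; rewrite -h.
  by case: n h => // n h; rewrite h.
apply: le_iff => i; rewrite part_col_gt//= tE.
exact: count_leq_gt.
Qed.

Definition history (lam : intpart) (i : nat) : option nat :=
  if i is j.+1 then Some (part_col lam j.+1) else None.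

(** The code of [lam] as a path for [path_weight]: nonzero columns lowered by 1, the final 0 being
    implicit. *)
Definition columns (lam : intpart) : seq nat :=
  [seq (part_col lam i).-1 | i <- iota 1 (largest_part lam)].

Lemma columns_inj : injective columns.
Proof.
move=> lam nu e; apply: part_col_inj => j.
have es : largest_part lam = largest_part nu.
  by have := congr1 size e; rewrite !size_map !size_iota.
have [jl|lj] := ltnP j (largest_part lam); last first.
  by rewrite !part_col_eq0// -es.
have := congr1 (fun s => nth 0%N s j) e.
rewrite !(nth_map 0%N) ?size_iota// -?es// nth_iota// add1n => /(congr1 succn).
by rewrite !prednK// part_col_gt0// -es.
Qed.

Lemma columns_surj (c : seq nat) : sorted geq c ->
  exists lam, columns lam = c.
Proof.
move=> sc; have cP : is_part (map succn c).
  apply/andP; split; last by apply/mapP => -[].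
  by rewrite sorted_map; apply: sub_sorted sc => x y.
have [lam ls lc] := transpose_exists _ cP.
exists lam; rewrite /columns ls size_map; apply: (@eq_from_nth _ 0%N).
  by rewrite size_map size_iota.
move=> i; rewrite size_map size_iota => ic.
by rewrite (nth_map 0%N) ?size_iota// nth_iota// add1n lc (nth_map 0%N).
Qed.

(** * The measure pi as a path weight *)

Section weights.
Context {R : realType}.
Variable p : nat.
Hypothesis p_gt1 : (1 < p)%N.

Local Notation q := (p%:R^-1 : R).

Lemma path_weight_unsorted (c : seq nat) :
  ~~ sorted geq c -> path_weight p None c = 0 :> R.
Proof.
case: c => [//|b c] /= bc.
suff -> : path_weight p (Some b.+1) c = 0 :> R by rewrite mulr0.
elim: c b bc => [//|x c ih] b /=; rewrite negb_and => /orP[bx|/ih ->].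
  by rewrite trans_Some_lt ?mul0r// ltnS ltnNge.
by rewrite mulr0.
Qed.

(** The starting time m is free for the induction on k; positivity of f undoes the predecessors. *)
Lemma path_weight_iota (f : nat -> nat) (h : nat -> option nat) m k :
  (forall i, h i.+1 = Some (f i.+1)) ->
  (forall i, (m < i <= m + k)%N -> (0 < f i)%N) ->
  path_weight p (h m) [seq (f i).-1 | i <- iota m.+1 k] =
  (\prod_(m <= i < m + k) trans R p (h i) (f i.+1)) * trans R p (h (m + k)%N) 0.
Proof.
move=> hS; elim: k m => [|k ih] m f0.
  by rewrite addn0 big_geq// mul1r.
rewrite big_ltn ?addnS ?ltnS ?leq_addr//= prednK; last first.
  by rewrite f0// ltnSn addnS ltnS leq_addr.
rewrite -hS -addSn ih ?mulrA// => i /andP[mi ik].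
by apply: f0; rewrite addnS -addSn ik andbT ltnW.
Qed.

(** The numerator (q)_a of K(a, b) cancels the denominator (q)_a of the preceding transition into a,
    so only the last [qexp_coef] survives. *)
Lemma prod_trans_telescope (lam : intpart) n :
  \prod_(0 <= i < n.+1) trans R p (history lam i) (part_col lam i.+1) =
  qpochoo q / qpochoo (q ^+ 2) *
  (\prod_(1 <= i < n.+1) (q ^+ 'C((part_col lam i).+1, 2) *
     qhalf q (part_col lam i - part_col lam i.+1))) *
  qexp_coef q (part_col lam n.+1).
Proof.
elim: n => [|n ih].
  rewrite big_nat1 big_geq// mulr1 trans_None//.
  by rewrite -mulrA [qexp_coef _ _ / _]mulrC.
rewrite big_nat_recr//= ih [in RHS]big_nat_recr//= trans_Some ?part_col_le//.
have -> : q ^+ 'C((part_col lam n.+1).+1, 2) =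
    qexp_coef q (part_col lam n.+1) * qpoch q (part_col lam n.+1).
  rewrite /qexp_coef mulfVK// lt0r_neq0//.
  by apply: qpoch_gt0; [exact: inv_gt0|exact: inv_lt1].
ring.
Qed.

Lemma trans_00 : trans R p (Some 0) 0 = 1 :> R.
Proof. by rewrite -[RHS](@sum_trans_Some R p p_gt1 0 1)// big_nat1. Qed.

(** After the last nonzero column the chain stays at 0 with probability 1, so further factors change
    nothing. *)
Lemma prod_trans_pi_part (lam : intpart) n : (largest_part lam < n)%N ->
  \prod_(0 <= i < n) trans R p (history lam i) (part_col lam i.+1) =
  pi_part R p lam.
Proof.
move=> ln; rewrite (big_cat_nat (n := (largest_part lam).+1))//=.
rewrite [X in _ * X]big_nat_cond [X in _ * X]big1 ?mulr1; last first.
  move=> [//|i] /andP[/andP[li _] _] /=.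
  by rewrite !part_col_eq0 ?trans_00// ltnW.
rewrite prod_trans_telescope part_col_eq0// /qexp_coef bin_small// expr0 qpoch0.
rewrite invr1 !mulr1 /pi_part infprod_odd_qpoch//; congr (_ * _).
rewrite big_split/= invfM; congr (_ * _).
  rewrite -exprVn -expr_sum; congr (_ ^+ _).
  by apply: eq_bigr => i _; rewrite bin2 /= divn2 mulnC.
by rewrite -prodfV; apply: eq_bigr => i _; rewrite prod_qpoch_sqr.
Qed.

Lemma path_weight_columns (lam : intpart) :
  path_weight p None (columns lam) = pi_part R p lam.
Proof.
rewrite (path_weight_iota (part_col lam) (history lam) 0)//; last first.
  by move=> i /andP[i0]; rewrite add0n -part_col_gt0.
rewrite add0n -(prod_trans_pi_part lam (largest_part lam).+1)//.
by rewrite big_nat_recr//= [in RHS](part_col_eq0 lam (largest_part lam).+1).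
Qed.

Lemma pi_part_ge0 (lam : intpart) : 0 <= pi_part R p lam.
Proof. by rewrite -path_weight_columns path_weight_ge0. Qed.

(** This is the total path weight from oo: unsorted codes weigh 0, and [columns] is a bijection onto
    the sorted ones. *)
Lemma esum_pi_part : \esum_(lam in [set: intpart]) (pi_part R p lam)%:E = 1%E.
Proof.
rewrite -[RHS](@esum_path_weight_None R p p_gt1).
rewrite (esumID [set c | sorted geq c] setT); last first.
  by move=> c _; rewrite lee_fin path_weight_ge0.
rewrite setTI [X in (_ + X)%E]esum1 ?adde0; last first.
  by move=> c [_ /= /negP sc]; rewrite path_weight_unsorted.
rewrite (reindex_esum setT _ columns).
  by apply: eq_esum => lam _; rewrite path_weight_columns.
split => [lam _ /=|lam nu _ _|c /= /columns_surj[lam <-]].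
- rewrite sorted_map; apply/(sortedP 0%N) => i; rewrite size_iota => il.
  rewrite !nth_iota//; last exact: ltnW.
  by rewrite /= -!subn1 leq_sub2r// part_col_le.
- exact: columns_inj.
- by exists lam.
Qed.

End weights.

(** * The law of the chain *)

Section chain.
Context {R : realType} (p : nat) (p_gt1 : (1 < p)%N).
Context (d : measure_display) (T : measurableType d) (P : probability T R).
Variable X : nat -> {RV P >-> nat}.
Hypothesis chainX : column_chain p X.

Let H (lam : intpart) n : set T :=
  [set w | forall i, (i <= n)%N -> state X i w = history lam i].

Let E (lam : intpart) : set T := [set w | is_transpose (fun j => X j w) lam].

Let H0 lam : H lam 0 = setT.
Proof. by apply/seteqP; split => // w _ [|]. Qed.

Let HS lam n : H lam n.+1 = H lam n `&` (X n @^-1` [set part_col lam n.+1]).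
Proof.
apply/seteqP; split => [w Hw|w [Hw /= Xw] i].
  by split => [i /leqW|]; [exact: Hw|have /= [] := Hw n.+1 (leqnn _)].
by rewrite leq_eqVlt => /predU1P[->|]; [rewrite /= Xw|exact: Hw].
Qed.

Let measurable_H lam n : measurable (H lam n).
Proof.
elim: n => [|n ih]; first by rewrite H0.
by rewrite HS; apply: measurableI => //; exact: measurable_funPTI.
Qed.

Let P_H lam n : P (H lam n) =
  (\prod_(0 <= i < n) trans R p (history lam i) (part_col lam i.+1))%:E.
Proof.
elim: n => [|n ih]; first by rewrite H0 big_geq// probability_setT.
rewrite HS (_ : X n @^-1` _ = [set w | state X n.+1 w = Some (part_col lam n.+1)]).
  by rewrite (chainX n (history lam)) ih big_nat_recr//= EFinM.
by apply/seteqP; split => [w /= ->//|w /= []].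
Qed.

Let E_bigcap lam : E lam = \bigcap_n H lam n.
Proof.
apply/seteqP; split => [w Ew n _ [//|i] _|w Hw j]; first by rewrite /= Ew.
by have /= [] := Hw j.+1 I j.+1 (leqnn _).
Qed.

Let measurable_E lam : measurable (E lam).
Proof. by rewrite E_bigcap; exact: bigcap_measurable. Qed.

(** Continuity from above along the decreasing events [H lam n], whose probabilities are constant
    once n exceeds the largest part. *)
Lemma probability_is_transpose lam :
  P [set w | is_transpose (fun j => X j w) lam] = (pi_part R p lam)%:E.
Proof.
rewrite -/(E lam) E_bigcap.
have c : (P \o H lam) n @[n --> \oo] --> P (\bigcap_n H lam n).
  apply: nonincreasing_cvg_mu => //.
  - by rewrite (le_lt_trans (probability_le1 _ _))// ltry.
  - exact: bigcap_measurable.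
  - by move=> m n mn; apply/subsetPset => w Hw i im; apply: Hw; exact: leq_trans mn.
apply: (cvg_unique _ c) => //.
apply: cvg_near_cst; near=> n.
rewrite /= P_H prod_trans_pi_part//.
by near: n; exists (largest_part lam).+1.
Unshelve. all: by end_near. Qed.

Let event (A : set intpart) : set T :=
  [set w | exists2 lam, A lam & is_transpose (fun j => X j w) lam].

(** Partitions are numbered by [pickle], which turns unions over them into unions indexed by
    naturals. *)
Let F k : set T := if unpickle k is Some lam then E lam else set0.

Let F_pickle lam : F (pickle lam) = E lam.
Proof. by rewrite /F pickleK. Qed.

Let event_bigcup A : event A = \bigcup_(k in pickle @` A) F k.
Proof.
apply/seteqP; split => [w [lam Al wl]|w [_ [lam Al <-]]].
  by exists (pickle lam); [exists lam|rewrite F_pickle].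
by rewrite F_pickle => wl; exists lam.
Qed.

Let measurable_F k : measurable (F k).
Proof. by rewrite /F; case: unpickle. Qed.

Let measurable_event A : measurable (event A).
Proof. by rewrite event_bigcup; exact: bigcup_measurable. Qed.

Lemma probability_is_transpose_in (A : set intpart) :
  P [set w | exists2 lam, A lam & is_transpose (fun j => X j w) lam]
  = \esum_(lam in A) (pi_part R p lam)%:E.
Proof.
rewrite -/(event A) event_bigcup measure_bigcup//; last first.
  (* Disjointness: a common outcome gives both partitions the same columns. *)
  move=> _ _ [lam _ <-] [nu _ <-]; rewrite !F_pickle => -[w [wl wn]].
  by congr pickle; apply: part_col_inj => j; rewrite -wl -wn.
rewrite nneseries_esum// (_ : [set x | x \in _] = pickle @` A); last first.
  by apply/seteqP; split => k /=; rewrite inE.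
rewrite esum_image; last by move=> lam nu _ _ /(pcan_inj pickleK).
by apply: eq_esum => lam _; rewrite F_pickle; exact: probability_is_transpose.
Qed.

(** Outside the event of being some transpose, whose probability is the total mass 1 of pi, only a
    null set remains. *)
Lemma ae_is_transpose :
  {ae P, forall w, (forall j, (X j.+1 w <= X j w)%N) /\
                   exists lam : intpart, is_transpose (fun j => X j w) lam}.
Proof.
exists (~` event setT); split; first exact: measurableC.
  by rewrite probability_setC// probability_is_transpose_in esum_pi_part// subee.
apply: subsetC => w [lam _ wl]; split; last by exists lam.
by move=> j; rewrite !wl part_col_le.
Qed.

End chain.

Theorem theorem3p1 (R : realType) (p : nat) (p_prime : prime p) :
  (* each K(a, .) is a probability distribution on the b <= a *)
  (forall a : option nat,
     (forall b : nat, 0 <= trans R p a b) /\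
     (\sum_(0 <= b <oo) (trans R p a b)%:E = 1)%E) /\
  (* pi is a probability measure on partitions *)
  ((forall lam : intpart, 0 <= pi_part R p lam) /\
   \esum_(lam in [set: intpart]) (pi_part R p lam)%:E = 1%E) /\
  (forall (d : measure_display) (T : measurableType d) (P : probability T R)
     (X : nat -> {RV P >-> nat}),
     column_chain p X ->
     {ae P, forall w, (forall j, (X j.+1 w <= X j w)%N) /\
                      exists lam : intpart, is_transpose (fun j => X j w) lam}
     /\
     (forall A : set intpart,
        P [set w | exists2 lam, A lam & is_transpose (fun j => X j w) lam]
        = \esum_(lam in A) (pi_part R p lam)%:E)).
Proof.
have p_gt1 := prime_gt1 p_prime.
split=> [a|]; first by split=> [b|]; [exact: trans_ge0|exact: nneseries_trans].
split=> [|d T P X chainX].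
  by split=> [lam|]; [exact: pi_part_ge0|exact: esum_pi_part].
by split=> [|A]; [exact: (ae_is_transpose p)|exact: probability_is_transpose_in].
Qed.
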